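(* Let $d\ge1$ and let $(\mathcal{F}_i)_{i=0}^d$ be a filtration. Let $X_1,\dots,X_d$ be integrable real random variables such that $X_i$ is $\mathcal{F}_i$-measurable for each $i$. Let $Y_1,\dots,Y_d$ be integrable real random variables that are mutually independent and independent of $\mathcal{F}_d$. Assume that for each $i\in\{1,\dots,d\}$ and every convex $\phi:\mathbb{R}\to\mathbb{R}$, $$\mathbb{E}[\phi(X_i)\mid\mathcal{F}_{i-1}]\le\mathbb{E}[\phi(Y_i)]\qquad\text{a.s.}$$ Then for every convex $f:\mathbb{R}^d\to\mathbb{R}$, $$\mathbb{E}[f(X_1,\dots,X_d)]\le\mathbb{E}[f(Y_1,\dots,Y_d)],$$ where both sides are understood as extended expectations in $(-\infty,\infty]$.
   Context: All random variables live on a common probability space. A real-valued convex function of an integrable random variable (or vector) is bounded below by an integrable affine function of it, so its expectation and conditional expectations are well defined with values in $(-\infty,\infty]$; (conditional) expectations of convex functions are understood in this extended sense. *)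

(* Defs.v *)
From mathcomp Require Import all_boot all_order all_algebra.
From mathcomp Require Import all_classical all_reals all_analysis.
From mathcomp Require Import measurable_realfun.

Set Implicit Arguments.
Unset Strict Implicit.
Unset Printing Implicit Defensive.

Import Order.TTheory GRing.Theory Num.Theory.
Import numFieldNormedType.Exports.

Local Open Scope classical_set_scope.
Local Open Scope ring_scope.
Local Open Scope ereal_scope.

(* The filtration indices 0, ..., d are the elements of 'I_d.+1. *)
Definition filtration (disp : measure_display) (T : measurableType disp)
    (d : nat) (F : 'I_d.+1 -> set_system T) : Prop :=
  [/\ forall i, sigma_algebra [set: T] (F i),
      forall i, F i `<=` measurable
    & forall i j : 'I_d.+1, (i <= j)%N -> F i `<=` F j].

(* [preimage_set_system [set: T] X measurable] is the sigma-algebra generated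
   by X alone. *)
Definition measurable_wrt (T : Type) (disp' : measure_display)
    (U : measurableType disp') (G : set_system T) (X : T -> U) : Prop :=
  preimage_set_system [set: T] X measurable `<=` G.

(* Z is a version of the extended conditional expectation of X given G, for X
   with integrable negative part: Z may take the value +oo, and both integrals
   below lie in ]-oo, +oo].  Versions exist and are almost surely unique. *)
Definition is_cond_expectation (disp : measure_display)
    (T : measurableType disp) (R : realType) (P : probability T R)
    (G : set_system T) (X : T -> R) (Z : T -> \bar R) : Prop :=
  [/\ measurable_wrt G Z,
      \int[P]_w Z^\- w < +oo
    & forall A, G A -> \int[P]_(w in A) Z w = \int[P]_(w in A) (X w)%:E].

(* E[X | G] <= c almost surely. *)
Definition cond_expectation_le (disp : measure_display)
    (T : measurableType disp) (R : realType) (P : probability T R)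
    (G : set_system T) (X : T -> R) (c : \bar R) : Prop :=
  exists2 Z, is_cond_expectation P G X Z & {ae P, forall w, Z w <= c}.

Definition mutually_independent (disp : measure_display)
    (T : measurableType disp) (R : realType) (P : probability T R)
    (I : finType) (X : I -> T -> R) : Prop :=
  forall (J : {set I}) (B : I -> set R), (forall i, measurable (B i)) ->
    P (\big[setI/setT]_(i in J) (X i @^-1` B i)) =
    \prod_(i in J) P (X i @^-1` B i).

Definition independent_systems (disp : measure_display)
    (T : measurableType disp) (R : realType) (P : probability T R)
    (G H : set_system T) : Prop :=
  forall A B, G A -> H B -> P (A `&` B) = P A * P B.

(* Main.v *)
(* Writing [f] as the increasing limit of maxima of finitely many affine
   functions, monotone convergence reduces to a convex Lipschitz [f], for which
   all the integrals are finite.  One then replaces [Y_k] by [X_k] for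
   k = 1, ..., d in turn.  Discretising the other coordinates, which are
   X_1, ..., X_(k-1), Y_(k+1), ..., Y_d, up to [e] splits the probability space
   into countably many boxes B `&` C with B in F_(k-1) and C in the
   sigma-algebra of Y_(k+1), ..., Y_d.  On such a box [f] is, up to O(e), a
   convex function [phi] of its k-th argument alone; by independence and the
   hypothesis,
     E[phi(X_k); B `&` C] = P(C) E[phi(X_k); B]
       <= P(C) P(B) E[phi(Y_k)] = E[phi(Y_k); B `&` C].
   Summing over the boxes and letting [e] tend to 0 avoids any use of product
   measures. *)
Require Import Defs.
From mathcomp Require Import all_boot all_order all_algebra.
From mathcomp Require Import all_classical all_reals all_analysis.
From mathcomp Require Import measurable_realfun.
From mathcomp Require Import ring lra.

Set Implicit Arguments.
Unset Strict Implicit.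
Unset Printing Implicit Defensive.

Import Order.TTheory GRing.Theory Num.Theory.
Import numFieldNormedType.Exports.

Local Open Scope classical_set_scope.
Local Open Scope ring_scope.

(** * Subgradients and countably many affine minorants of a convex function *)

Section Subgradient.
Variables (R : realType) (d : nat).
Implicit Types (f : 'rV[R]_d -> R) (s x y v : 'rV[R]_d).

Definition dot s x : R := \sum_i s ord0 i * x ord0 i.

Lemma dotDr s x y : dot s (x + y) = dot s x + dot s y.
Proof. by rewrite -big_split; apply: eq_bigr => i _; rewrite mxE mulrDr. Qed.

Lemma dotZr s a x : dot s (a *: x) = a * dot s x.
Proof. by rewrite mulr_sumr; apply: eq_bigr => i _; rewrite mxE mulrCA. Qed.

Lemma dot0r s : dot s 0 = 0.
Proof. by rewrite /dot big1 // => i _; rewrite mxE mulr0. Qed.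

Lemma dotBr s x y : dot s (x - y) = dot s x - dot s y.
Proof. by rewrite dotDr -scaleN1r dotZr mulN1r. Qed.

Lemma convex_functionP (E : lmodType R) (f : E -> R) :
  @convex_function R E [set: E] f <->
  forall (t : R) (x y : E), 0 <= t -> t <= 1 ->
    f (t *: x + (1 - t) *: y) <= t * f x + (1 - t) * f y.
Proof.
split => [cf t x y t0 t1|cf t x y _ _].
  by have := cf (Itv01 t0 t1) x y; rewrite !inE; apply.
by apply: cf.
Qed.

(* The value [c] of the functional on the new basis vector has to lie between
   all the quotients [L] and all the quotients [U] below; convexity puts every
   [L] below every [U]. *)
Lemma convex_extend_functional (g : 'rV[R]_d -> R) (e s : 'rV[R]_d)
    (V : set 'rV[R]_d) :
  @convex_function R 'rV[R]_d [set: _] g ->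
  V 0 -> (forall a b v w, V v -> V w -> V (a *: v + b *: w)) ->
  (forall v, V v -> dot s v <= g v) ->
  exists c, forall v t, V v -> dot s v + c * t <= g (v + t *: e).
Proof.
move=> /convex_functionP cg V0 VD sg.
pose U v t := (g (v + t *: e) - dot s v) / t.
pose L v t := (dot s v - g (v - t *: e)) / t.
have LU v t w r : V v -> V w -> 0 < t -> 0 < r -> L w r <= U v t.
  move=> Vv Vw t0 r0; rewrite /L /U ler_pdivrMr// mulrAC ler_pdivlMr//.
  have tr0 : 0 < t + r by rewrite addr_gt0.
  (* This weight makes the two multiples of [e] cancel in the convex combination, leaving the point
     [l *: v + (1 - l) *: w] of [V]. *)
  pose l := r / (t + r).
  have l0 : 0 <= l by rewrite divr_ge0 ?ltW.
  have l1 : l <= 1 by rewrite /l ler_pdivrMr// mul1r lerDr ltW.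
  have lE : 1 - l = t / (t + r) by rewrite /l; field; rewrite gt_eqF.
  have := cg l (v + t *: e) (w - r *: e) l0 l1.
  have -> : l *: (v + t *: e) + (1 - l) *: (w - r *: e) = l *: v + (1 - l) *: w.
    apply/rowP => i; rewrite !mxE lE /l; field; by rewrite gt_eqF.
  move=> /(le_trans (sg _ (VD _ _ _ _ Vv Vw))).
  rewrite dotDr !dotZr lE /l -(ler_pM2r tr0) => H.
  have : r * dot s v + t * dot s w <=
      r * g (v + t *: e) + t * g (w - r *: e).
    move: H; congr (_ <= _); field; by rewrite gt_eqF.
  by lra.
pose S := [set L p.1 p.2 | p in [set p : 'rV[R]_d * R | V p.1 /\ 0 < p.2]].
have Sub v t : V v -> 0 < t -> ubound S (U v t).
  by move=> Vv t0 _ [[w r] /= [Vw r0] <-]; exact: LU.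
have hS : has_sup S.
  split; first by exists (L 0 1), (0, 1).
  by exists (U 0 1); exact: Sub.
(* A negative [t] is handled by the quotient [L v (- t)], a positive one by [U v t]. *)
exists (sup S) => v t Vv.
have [t0|t0|->] := ltgtP t 0.
- have : L v (- t) <= sup S.
    by apply: ub_le_sup; [case: hS|exists (v, - t) => //=; rewrite oppr_gt0].
  rewrite /L ler_pdivrMr ?oppr_gt0// scaleNr opprK; lra.
- have : sup S <= U v t by apply: ge_sup; [case: hS|exact: Sub].
  rewrite /U ler_pdivlMr//; lra.
- by rewrite mulr0 scale0r !addr0; exact: sg.
Qed.

(** Finite-dimensional Hahn-Banach: starting from the zero functional on {0}, a linear functional
    dominated by the increment [g] of [f] at [x] is extended one basis vector at a time. *)
Lemma convex_subgradient f x : @convex_function R 'rV[R]_d [set: _] f ->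
  exists s, forall y, f x + dot s (y - x) <= f y.
Proof.
move=> cf; pose g v := f (x + v) - f x.
have cg : @convex_function R 'rV[R]_d [set: _] g.
  apply/convex_functionP => t v w t0 t1; rewrite /g.
  have -> : x + (t *: v + (1 - t) *: w) = t *: (x + v) + (1 - t) *: (x + w).
    by apply/rowP => i; rewrite !mxE; ring.
  have /convex_functionP/(_ t (x + v) (x + w) t0 t1) := cf; lra.
suff H k : (k <= d)%N -> exists s, forall v,
    (forall i : 'I_d, (k <= i)%N -> v ord0 i = 0) -> dot s v <= g v.
  have [s sP] := H d (leqnn d); exists s => y.
  have : dot s (y - x) <= g (y - x) by apply: sP => i; rewrite leqNgt ltn_ord.
  by rewrite /g subrKC; lra.
elim: k => [_|k IH kd].
  exists 0 => v v0; have -> : v = 0 by apply/rowP => i; rewrite v0// mxE.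
  by rewrite dot0r /g addr0 subrr.
have [s sP] := IH (ltnW kd); pose i0 := Ordinal kd.
pose V : set 'rV[R]_d := [set v | forall i : 'I_d, (k <= i)%N -> v ord0 i = 0].
have [|||c cP] := @convex_extend_functional g (delta_mx ord0 i0) s V cg.
- by move=> i _; rewrite mxE.
- by move=> a b v w Vv Vw i ki; rewrite !mxE Vv// Vw// !mulr0 addr0.
- exact: sP.
exists (\row_i if i == i0 then c else s ord0 i) => w w0.
pose v : 'rV[R]_d := \row_i if i == i0 then 0 else w ord0 i.
have Vv : V v.
  move=> i ki; rewrite mxE; case: (eqVneq i i0) => // ii0.
  apply: w0; rewrite ltn_neqAle ki andbT.
  by apply: contra_neq ii0 => kE; apply: val_inj.
have := cP v (w ord0 i0) Vv; congr (_ <= g _); last first.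
  apply/rowP => i; rewrite !mxE eqxx/=; case: eqVneq => [->|_] /=; ring.
rewrite /dot (bigD1 i0)//= [RHS](bigD1 i0)//= !mxE eqxx mulr0 add0r addrC.
by congr (_ + _); apply: eq_bigr => i /negbTE ii0; rewrite !mxE ii0.
Qed.

Lemma dist_le_of_floor_eq (c x y : R) : 0 < c ->
  Num.floor (x * c) = Num.floor (y * c) -> `|x - y| <= c^-1.
Proof.
move=> c0 xy; rewrite -(ler_pM2r c0) mulVf ?gt_eqF//.
rewrite -[X in _ * X](gtr0_norm c0) -normrM mulrBl.
have /andP[x1 x2] := mem_rg1_floor (x * c).
have /andP[y1 y2] := mem_rg1_floor (y * c).
by rewrite ler_norml; move: x1 x2 y1 y2; rewrite xy; lra.
Qed.

(* A set of pairs (slope, intercept) has a countable dense subset: choose one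
   of its elements in each grid cell that it meets. *)
Lemma convex_countable_affine_minorants f :
  @convex_function R 'rV[R]_d [set: _] f ->
  exists (a : nat -> 'rV[R]_d) (b : nat -> R),
    (forall n x, dot (a n) x + b n <= f x) /\
    (forall x e, 0 < e -> exists n, f x - e <= dot (a n) x + b n).
Proof.
move=> cf; pose minorant (p : 'rV[R]_d * R) := forall x, dot p.1 x + p.2 <= f x.
have supp x : exists2 p, minorant p & dot p.1 x + p.2 = f x.
  have [s sP] := convex_subgradient x cf; exists (s, f x - dot s x) => /=.
    by move=> y; have := sP y; rewrite dotBr /=; lra.
  by rewrite addrC subrK.
(* The grid at scale [n] has mesh [1 / (n + 1)], both for the slope and for the intercept. *)
pose cell (n : nat) (p : 'rV[R]_d * R) : 'rV[int]_d * int :=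
  (\row_i Num.floor (p.1 ord0 i * n.+1%:R), Num.floor (p.2 * n.+1%:R)).
have /choice[h hP] (m : nat) : exists r, minorant r /\
    forall c n, unpickle m = Some (c, n) ->
      (exists2 p, minorant p & cell n p = c) -> cell n r = c.
  (* [p0] is the default for a code that decodes to no pair, or to a cell that no minorant meets. *)
  have [p0 p0P _] := supp 0.
  case: (unpickle m) => [[c n]|]; last by exists p0.
  have [[p pP pc]|nex] := pselect (exists2 p, minorant p & cell n p = c).
    by exists p; split=> // c' n' [<- <-].
  by exists p0; split=> // c' n' [<- <-].
exists (fun m => (h m).1), (fun m => (h m).2); split.
  by move=> m x; case: (hP m).
move=> x e e0; have [p pP px] := supp x.
(* The sum weighs the errors of the slope at [x]; the 1 pays for the error of the intercept. *)
pose M : R := \sum_i `|x ord0 i| + 1.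
have M0 : 0 < M by rewrite ltr_wpDl ?sumr_ge0.
have [n nP] : exists n : nat, M / e <= n.+1%:R.
  exists (Num.truncn (M / e)); rewrite ltW//.
  exact: truncnS_gt.
pose m := pickle (cell n p, n); exists m.
have [mM] := hP m; move=> /(_ (cell n p) n); rewrite pickleK => /(_ erefl).
move=> /(_ (ex_intro2 _ _ p pP erefl)) [/rowP cellE1 cellE2].
have n0 : 0 < n.+1%:R :> R by rewrite ltr0n.
have h1 i : `|p.1 ord0 i - (h m).1 ord0 i| <= n.+1%:R^-1.
  by apply: dist_le_of_floor_eq => //; have := cellE1 i; rewrite !mxE => ->.
have h2 : `|p.2 - (h m).2| <= n.+1%:R^-1.
  by apply: dist_le_of_floor_eq.
rewrite -px lerBlDl -lerBlDr.
have -> : dot p.1 x + p.2 - (dot (h m).1 x + (h m).2) =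
    \sum_i (p.1 ord0 i - (h m).1 ord0 i) * x ord0 i + (p.2 - (h m).2).
  rewrite /dot opprD addrACA -sumrB; congr (_ + _).
  by apply: eq_bigr => i _; rewrite mulrBl.
apply: (@le_trans _ _ (n.+1%:R^-1 * M)); last first.
  by rewrite mulrC ler_pdivrMr// mulrC -ler_pdivrMr.
rewrite mulrDr mulr1 mulr_sumr lerD//; last exact: le_trans (ler_norm _) h2.
by apply: ler_sum => i _; rewrite (le_trans (ler_norm _))// normrM ler_wpM2r.
Qed.

End Subgradient.

(** * Maxima of finitely many affine functions *)

Section MaxAffine.
Variables (R : realType) (d : nat).
Implicit Types (f g : 'rV[R]_d -> R).

Definition l1_lipschitz (L : R) f :=
  forall x y, `|f x - f y| <= L * \sum_i `|x ord0 i - y ord0 i|.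

(** Measurability is tested on vectors of measurable coordinates, so no sigma-algebra on ['rV[R]_d]
    is involved. The space [T] is arbitrary, which later allows [T := R] for slices. *)
Definition preserves_measurability f :=
  forall disp (T : measurableType disp) (V : 'I_d -> T -> R),
    (forall i, measurable_fun [set: T] (V i)) ->
    measurable_fun [set: T] (fun w => f (\row_i V i w)).

Variables (a : nat -> 'rV[R]_d) (b : nat -> R).

Fixpoint max_affine (n : nat) (x : 'rV[R]_d) : R :=
  if n is m.+1 then Num.max (max_affine m x) (dot (a n) x + b n)
  else dot (a 0%N) x + b 0%N.

Lemma max_affine_convex n :
  @convex_function R 'rV[R]_d [set: _] (max_affine n).
Proof.
have aff m (t : R) (x y : 'rV[R]_d) : dot (a m) (t *: x + (1 - t) *: y) + b m =
    t * (dot (a m) x + b m) + (1 - t) * (dot (a m) y + b m).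
  by rewrite dotDr !dotZr; ring.
elim: n => [|n /convex_functionP IH]; apply/convex_functionP => t x y t0 t1.
  by rewrite /= aff.
have t1' : 0 <= 1 - t by rewrite subr_ge0.
rewrite /= ge_max aff; apply/andP; split; last first.
  by rewrite lerD// ler_wpM2l// le_max lexx orbT.
by rewrite (le_trans (IH _ _ _ t0 t1))// lerD// ler_wpM2l// le_max lexx.
Qed.

Lemma max_affine_lipschitz n :
  exists2 L, 0 <= L & l1_lipschitz L (max_affine n).
Proof.
have aff m x y : `|(dot (a m) x + b m) - (dot (a m) y + b m)| <=
    (\sum_i `|a m ord0 i|) * \sum_i `|x ord0 i - y ord0 i|.
  rewrite opprD addrACA subrr addr0 -dotBr mulr_suml.
  rewrite (le_trans (ler_norm_sum _ _ _))//; apply: ler_sum => i _.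
  rewrite normrM !mxE ler_wpM2l// (bigD1 i)//= lerDl.
  by rewrite sumr_ge0.
elim: n => [|n [L L0 IH]].
  by exists (\sum_i `|a 0%N ord0 i|); [rewrite sumr_ge0|exact: aff].
(* The sum of the two Lipschitz constants dominates their maximum; any finite constant will do. *)
exists (L + \sum_i `|a n.+1 ord0 i|); first by rewrite addr_ge0// sumr_ge0.
move=> x y /=; have := IH x y; have := aff n.+1 x y.
rewrite [(L + _) * _]mulrDl.
have : 0 <= L * \sum_i `|x ord0 i - y ord0 i| by rewrite mulr_ge0// sumr_ge0.
have : 0 <= (\sum_i `|a n.+1 ord0 i|) * \sum_i `|x ord0 i - y ord0 i|.
  by rewrite mulr_ge0// sumr_ge0.
move: (_ * _) (_ * _) (dot _ _ + _) (dot _ _ + _).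
move: (max_affine _ _) (max_affine _ _).
move=> r s u v p q u0 v0; rewrite !ler_norml => /andP[p1 p2] /andP[r1 r2].
by case: (leP r p); case: (leP s q) => *; apply/andP; split; lra.
Qed.

Lemma max_affine_measurable n : preserves_measurability (max_affine n).
Proof.
move=> disp T V mV.
have aff m : measurable_fun [set: T] (fun w => dot (a m) (\row_i V i w) + b m).
  apply: measurable_funD => //; rewrite /dot.
  apply: measurable_sum => i; under eq_fun do rewrite mxE.
  by apply: measurable_funM.
elim: n => [|n IH] /=; first exact: aff.
exact: measurable_maxr.
Qed.

Lemma max_affine_homo m n x : (m <= n)%N -> max_affine m x <= max_affine n x.
Proof.
move: m n; apply/nondecreasing_seqP => n /=.
by rewrite le_max lexx.
Qed.

Lemma affine_le_max_affine n x : dot (a n) x + b n <= max_affine n x.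
Proof. by case: n => //= n; rewrite le_max lexx orbT. Qed.

Lemma max_affine_le f : (forall n x, dot (a n) x + b n <= f x) ->
  forall n x, max_affine n x <= f x.
Proof. by move=> abf; elim=> [|n IH] x //=; rewrite ge_max IH/=. Qed.

Lemma max_affine_cvg f : (forall n x, dot (a n) x + b n <= f x) ->
  (forall x e, 0 < e -> exists n, f x - e <= dot (a n) x + b n) ->
  forall x, max_affine n x @[n --> \oo] --> f x.
Proof.
move=> abf fab x; apply/cvgrPdist_le => e e0.
have [N NP] := fab x e e0.
near=> n; have Nn : (N <= n)%N by near: n; exact: nbhs_infty_ge.
rewrite ger0_norm ?subr_ge0 ?max_affine_le// lerBlDl -lerBlDr.
by rewrite (le_trans NP)// (le_trans (affine_le_max_affine _ _))//
  max_affine_homo.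
Unshelve. all: by end_near. Qed.

End MaxAffine.

(** * Change of variables under a scaled law, and monotone limits *)

Section Integrals.
Local Open Scope ereal_scope.
Context (disp : measure_display) (T : measurableType disp) (R : realType).
Variable mu : {measure set T -> \bar R}.

Lemma ge0_integral_mrestr (A : set T) (mA : measurable A) (g : T -> \bar R) :
  measurable_fun [set: T] g -> (forall x, 0 <= g x) ->
  \int[mrestr mu mA]_x g x = \int[mu]_(x in A) g x.
Proof.
move=> mg g0.
have mAC : measurable (~` A) by exact: measurableC.
rewrite (@ge0_negligible_integral _ _ _ (mrestr mu mA) _ (~` A))//=; last first.
  by rewrite /mrestr setICl measure0.
rewrite setTD setCK; apply: eq_measure_integral => B mB BA.
by rewrite /= /mrestr setIidl.
Qed.

(** The last hypothesis says that the law of [V] restricted to [A] is [c] times its law restricted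
    to [B]. Independence enters the integrals in this form, without product measures. *)
Lemma ge0_integral_comp_scaled (A B : set T) (c : {nonneg R}) (V : T -> R)
    (phi : R -> \bar R) :
  measurable A -> measurable B ->
  measurable_fun [set: T] V -> measurable_fun [set: R] phi ->
  (forall x, 0 <= phi x) ->
  (forall S, measurable S ->
    mu (A `&` V @^-1` S) = c%:num%:E * mu (B `&` V @^-1` S)) ->
  \int[mu]_(w in A) phi (V w) = c%:num%:E * \int[mu]_(w in B) phi (V w).
Proof.
move=> mA mB mV mphi phi0 AB.
have push (C : set T) (mC : measurable C) : \int[mu]_(w in C) phi (V w) =
    \int[pushforward (mrestr mu mC) V]_x phi x.
  rewrite -(ge0_integral_mrestr mC)//; last exact: measurableT_comp.
  by rewrite ge0_integral_pushforward.
rewrite (push _ mA) (push _ mB) -ge0_integral_mscale//.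
apply: eq_measure_integral => S mS _ /=.
rewrite /mscale/= /pushforward /mrestr /= setIC AB//; congr (_ * mu _).
by rewrite setIC.
Qed.

Lemma integral_comp_scaled (A B : set T) (c : {nonneg R}) (V : T -> R)
    (phi : R -> R) :
  measurable A -> measurable B ->
  measurable_fun [set: T] V -> measurable_fun [set: R] phi ->
  (forall S, measurable S ->
    mu (A `&` V @^-1` S) = c%:num%:E * mu (B `&` V @^-1` S)) ->
  mu.-integrable B (EFin \o (phi \o V)) ->
  \int[mu]_(w in A) (phi (V w))%:E =
  c%:num%:E * \int[mu]_(w in B) (phi (V w))%:E.
Proof.
move=> mA mB mV mphi AB iB.
have mE : measurable_fun [set: R] (EFin \o phi) by exact/measurable_EFinP.
rewrite integralE [in RHS]integralE.
(* Distributing over the difference is legitimate because the positive part has a finite integral on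
   [B]. *)
rewrite muleBr//; last first.
  have := integrable_pos_fin_num mB iB.
  exact: fin_num_adde_defr.
have posE : (fun w => (phi (V w))%:E)^\+ = (EFin \o phi)^\+ \o V.
  by apply/funext => w /=; rewrite !funeposE.
have negE : (fun w => (phi (V w))%:E)^\- = (EFin \o phi)^\- \o V.
  by apply/funext => w /=; rewrite !funenegE.
rewrite posE negE; congr (_ - _); apply: ge0_integral_comp_scaled => //.
  exact: measurable_funepos.
exact: measurable_funeneg.
Qed.

(** The negative part of [h] is at most that of [g], hence has a finite integral, so only the
    positive part can prevent integrability. *)
Lemma integral_eq_pinfty (g h : T -> \bar R) :
  measurable_fun [set: T] h -> mu.-integrable [set: T] g ->
  (forall x, g x <= h x) -> ~ mu.-integrable [set: T] h ->
  \int[mu]_x h x = +oo.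
Proof.
move=> mh ig gh nih.
have mg : measurable_fun [set: T] g by exact: measurable_int ig.
have hN : \int[mu]_x h^\- x < +oo.
  apply: le_lt_trans (integral_funeneg_lt_pinfty measurableT ig).
  apply: ge0_le_integral => //; [exact: measurable_funeneg..|].
  by move=> x _; rewrite !funenegE ge_max !le_max leeN2 gh lexx orbT.
have h0 : 0 <= \int[mu]_x h^\- x by exact: integral_ge0.
have hNfin : \int[mu]_x h^\- x \is a fin_num by rewrite ge0_fin_numE.
rewrite integralE; suff -> : \int[mu]_x h^\+ x = +oo.
  by rewrite addye//; move: hNfin; rewrite -fin_numN fin_numE => /andP[].
apply: contrapT => /eqP; rewrite -ltey => hP.
apply/nih/integrableP; split => //.
rewrite (_ : (fun x => `|h x|) = h^\+ \+ h^\-); last first.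
  by rewrite -fune_abse.
rewrite ge0_integralD//; last 2 first.
- exact: measurable_funepos.
- exact: measurable_funeneg.
exact: lte_add_pinfty.
Qed.

(** Monotone convergence applies to the nonnegative functions [g n - g 0]. The resulting finite
    bound makes [f - g 0] integrable, so that [g 0] can be added back. *)
Lemma integral_le_of_nondecreasing_cvg (g : nat -> T -> R) (f : T -> R)
    (c : R) :
  (forall n, mu.-integrable [set: T] (EFin \o g n)) ->
  (forall w, nondecreasing_seq (g ^~ w)) ->
  (forall w, g n w @[n --> \oo] --> f w) ->
  (forall n, \int[mu]_w (g n w)%:E <= c%:E) ->
  \int[mu]_w (f w)%:E <= c%:E.
Proof.
move=> ig ndg gf gc.
have mg n : measurable_fun [set: T] (g n).
  by apply/measurable_EFinP; exact: measurable_int (ig n).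
have mf : measurable_fun [set: T] f.
  by apply: (@measurable_fun_cvg _ _ _ _ g).
have fin0 := integrable_fin_num measurableT (ig 0%N).
have ge0 n w : (0 <= g n w - g 0%N w)%R by rewrite subr_ge0; exact: ndg.
have limE w : limn (fun n => (g n w - g 0%N w)%:E) = (f w - g 0%N w)%:E.
  apply/cvg_lim => //; apply: cvg_EFin; first by near=> n.
  apply: cvgB; [exact: gf|exact: cvg_cst].
have H : \int[mu]_w (f w - g 0%N w)%:E <= c%:E - \int[mu]_w (g 0%N w)%:E.
  under eq_integral do rewrite -limE.
  rewrite monotone_convergence//; first last.
  - by move=> w _ m n mn; rewrite lee_fin lerD2r; exact: ndg.
  - by move=> n w _; rewrite lee_fin.
  - by move=> n; apply/measurable_EFinP; exact: measurable_funB.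
  apply: lime_le.
    apply: ereal_nondecreasing_is_cvgn => m n mn; apply: ge0_le_integral => //.
    - by move=> w _; rewrite lee_fin.
    - by apply/measurable_EFinP; exact: measurable_funB.
    - by apply/measurable_EFinP; exact: measurable_funB.
    - by move=> w _; rewrite lee_fin lerD2r; exact: ndg.
  apply: nearW => n; under eq_integral do rewrite EFinB.
  rewrite (integralB measurableT (ig n) (ig 0%N)).
  by apply: leeB; [exact: gc|exact: lexx].
have fg w : (g 0%N w <= f w)%R.
  rewrite -(cvg_lim _ (gf w))//; apply: nondecreasing_cvgn_le => //.
  by apply/cvg_ex; exists (f w).
have i0 : mu.-integrable [set: T] (fun w => (f w - g 0%N w)%:E).
  apply/integrableP; split.
    by apply/measurable_EFinP; exact: measurable_funB.
  under eq_integral do rewrite /= ger0_norm ?subr_ge0//.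
  apply: le_lt_trans H _; rewrite -(fineK fin0) -EFinB; exact: ltry.
have -> : \int[mu]_w (f w)%:E =
    \int[mu]_w ((f w - g 0%N w)%:E + (g 0%N w)%:E).
  by apply: eq_integral => w _; rewrite -EFinD subrK.
rewrite (integralD measurableT i0 (ig 0%N)) -leeBrDr//.
Unshelve. all: by end_near. Qed.

End Integrals.

(** * Summation over a countable partition, and integrated conditional bounds *)

Section Probability.
Local Open Scope ereal_scope.
Context (disp : measure_display) (T : measurableType disp) (R : realType).
Variable P : probability T R.

(** The error allowed on a cell is proportional to its probability, so infinitely many cells cost
    only [c] in total. *)
Lemma integral_le_of_countable_partition (A : nat -> set T) (H : T -> R)
    (c : R) :
  (forall n, measurable (A n)) -> trivIset setT A -> \bigcup_n A n = [set: T] ->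
  P.-integrable [set: T] (EFin \o H) ->
  (forall n, \int[P]_(w in A n) (H w)%:E <= c%:E * P (A n)) ->
  \int[P]_w (H w)%:E <= c%:E.
Proof.
move=> mA tA UA iH HA.
have ic : P.-integrable [set: T] (EFin \o cst c).
  exact: finite_measure_integrable_cst.
have : \int[P]_w ((H w)%:E - c%:E) <= 0.
  rewrite -UA integral_bigcup//; last by rewrite UA; exact: integrableB.
  apply: npeseries_le0 => n _ _; rewrite integralB//.
  - rewrite sube_le0 (le_trans (HA n))// integral_cst//.
  - exact: integrableS iH.
  - exact: integrableS ic.
rewrite integralB//= integral_cst//= probability_setT mule1.
by rewrite sube_le0.
Qed.

Lemma cond_expectation_le_integral (G : set_system T) (X : T -> R) (c : R)
    (A : set T) :
  G `<=` measurable -> cond_expectation_le P G X c%:E -> G A ->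
  \int[P]_(w in A) (X w)%:E <= c%:E * P A.
Proof.
move=> Gm [Z [mZ _ ZX] Zc] GA; rewrite -ZX//.
have mA : measurable A by exact: Gm.
have mZT : measurable_fun [set: T] Z.
  by move=> _ B mB; apply/Gm/mZ; exists B.
have mZA : measurable_fun A Z by exact: measurable_funTS.
(* [Z] may be non-integrable, so the almost sure bound is used on positive and negative parts
   separately. *)
rewrite -integral_cst// [leLHS]integralE [leRHS]integralE leeB//.
- apply: ae_ge0_le_integral => //; first exact: measurable_funepos.
    exact: measurable_funepos.
  by apply: filterS Zc => w Zw _; rewrite !funeposE ge_max !le_max Zw lexx orbT.
- apply: ae_ge0_le_integral => //; first exact: measurable_funeneg.
    exact: measurable_funeneg.
  by apply: filterS Zc => w Zw _;
    rewrite !funenegE ge_max !le_max leeN2 Zw lexx orbT.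
Qed.

End Probability.

(** * Finite intersections and measurability of grid cells *)

Section FiniteIntersections.

Lemma in_bigsetI (T : Type) (I : finType) (Q : pred I) (E : I -> set T)
    (w : T) :
  (\big[setI/setT]_(i | Q i) E i) w <-> forall i, Q i -> E i w.
Proof.
split => [H i Qi|H]; first by move: H; rewrite (bigD1 i)//= => -[].
by elim/big_rec: _ => // i A Qi Aw; split => //; exact: H.
Qed.

Lemma sigma_algebra_bigsetI (T : Type) (G : set_system T) (I : finType)
    (Q : pred I) (E : I -> set T) :
  sigma_algebra [set: T] G -> (forall i, Q i -> G (E i)) ->
  G (\big[setI/setT]_(i | Q i) E i).
Proof.
move=> /(sigma_algebraP (fun A _ => @subsetT _ A))[GT _ _ GI] GE.
exact: big_ind.
Qed.

Lemma measurable_floor_cell (R : realType) (c : R) (m : int) : 0 < c ->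
  measurable [set x : R | Num.floor (x * c) = m].
Proof.
move=> c0; have mfl : measurable_fun [set: R] (fun x : R => Rfloor (x * c)).
  apply: nondecreasing_measurable => // x y xy; apply: le_Rfloor.
  by rewrite ler_pM2r.
have := mfl measurableT [set m%:~R] (measurable_set1 _).
rewrite setTI; congr measurable; apply/seteqP; split => x /=.
  by rewrite /Rfloor => /intr_inj.
by rewrite /Rfloor => ->.
Qed.

End FiniteIntersections.

(** * Integrability of Lipschitz functions of integrable coordinates *)

Section Lipschitz.
Context (R : realType) (d : nat) (disp : measure_display)
  (T : measurableType disp) (P : probability T R).

Lemma lipschitz_integrable (f : 'rV[R]_d -> R) (L : R) (V : 'I_d -> T -> R) :
  l1_lipschitz L f -> preserves_measurability f ->
  (forall i, P.-integrable [set: T] (EFin \o V i)) ->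
  P.-integrable [set: T] (fun w => (f (\row_i V i w))%:E).
Proof.
move=> fL fm iV.
have mV i : measurable_fun [set: T] (V i).
  by apply/measurable_EFinP; exact: measurable_int (iV i).
have iB : P.-integrable [set: T]
    (fun w => (`|f 0|)%:E + L%:E * \sum_(i < d) `|(V i w)%:E|)%E.
  apply: (@integrableD _ _ _ P _ measurableT (EFin \o cst `|f 0|)).
    exact: finite_measure_integrable_cst.
  apply: integrableZl => //.
  apply: (@integrable_sum _ _ _ P _ measurableT _ _ _
    (fun i w => `|(V i w)%:E|)%E).
  by move=> i _; exact: (integrable_abse (iV i)).
apply: le_integrable iB => //; first by apply/measurable_EFinP; exact: fm.
move=> w _; rewrite sumEFin -EFinM -EFinD lee_fin.
have := fL (\row_i V i w) 0; under eq_bigr do rewrite !mxE subr0.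
(* No sign of [L] is assumed: the Lipschitz bound itself shows that the product with [L] is
   nonnegative. *)
move=> fw; rewrite [leRHS]ger0_norm; last first.
  by rewrite addr_ge0// (le_trans _ fw).
by rewrite -lerBlDl (le_trans _ fw)// lerB_dist.
Qed.

End Lipschitz.

(** * Restriction of a function to a line parallel to a coordinate axis *)

Section Slice.
Variables (R : realType) (d : nat) (f : 'rV[R]_d -> R) (k : 'I_d)
  (c : 'I_d -> R).

Definition slice (t : R) : R := f (\row_i if i == k then t else c i).

Lemma slice_convex : @convex_function R 'rV[R]_d [set: _] f ->
  @convex_function R R^o [set: R^o] slice.
Proof.
move=> /convex_functionP cf; apply/convex_functionP => t x y t0 t1.
apply: le_trans (cf t _ _ t0 t1); rewrite /slice le_eqVlt; apply/orP; left.
apply/eqP; congr f; apply/rowP => i; rewrite !mxE; case: ifP => // _; ring.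
Qed.

Lemma slice_measurable : preserves_measurability f ->
  measurable_fun [set: R] slice.
Proof.
move=> fm; apply: (fm _ _ (fun i t => if i == k then t else c i)) => i.
by case: (i == k).
Qed.

Lemma slice_dist (L e : R) (x : 'rV[R]_d) : l1_lipschitz L f -> 0 <= L ->
  0 <= e -> (forall i, i != k -> `|x ord0 i - c i| <= e) ->
  `|f x - slice (x ord0 k)| <= L * (d%:R * e).
Proof.
move=> fL L0 e0 xc; rewrite (le_trans (fL _ _))// ler_wpM2l//.
rewrite -[d in d%:R](card_ord d) mulr_natl -sumr_const.
apply: ler_sum => i _; rewrite mxE; case: eqVneq => [->|/xc//].
by rewrite subrr normr0.
Qed.

End Slice.

(** * Replacement of the coordinates one at a time *)

Section Swap.
Local Open Scope ereal_scope.
Context (R : realType) (disp : measure_display)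
    (T : measurableType disp) (P : probability T R) (d : nat)
    (F : 'I_d.+1 -> set_system T) (X Y : 'I_d -> {RV P >-> R}).
Hypotheses (filtF : filtration F)
  (intX : forall i, P.-integrable [set: T] (EFin \o X i))
  (adapted : forall i, measurable_wrt (F (lift ord0 i)) (X i))
  (intY : forall i, P.-integrable [set: T] (EFin \o Y i))
  (indepY : mutually_independent P Y)
  (indepYF : independent_systems P (g_sigma_preimage Y) (F ord_max))
  (XleY : forall (i : 'I_d) (phi : R -> R),
     @convex_function R R^o [set: R^o] phi ->
     cond_expectation_le P (F (widen_ord (leqnSn d) i)) (phi \o X i)
       'E_P[phi \o Y i]).

Let sF i : sigma_algebra [set: T] (F i). Proof. by case: filtF. Qed.
Let Fm i : F i `<=` measurable. Proof. by case: filtF. Qed.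
Let Fhomo (i j : 'I_d.+1) : (i <= j)%N -> F i `<=` F j.
Proof. by case: filtF => _ _; apply. Qed.

(** Interpolates between the vector [Y] at [n = 0] and the vector [X] at [n = d]. *)
Definition mixed (n : nat) (i : 'I_d) (w : T) : R :=
  if (i < n)%N then X i w else Y i w.

Section Box.
Variables (k : 'I_d) (S : 'I_d -> set R).
Hypothesis mS : forall i, measurable (S i).

Definition past_box := \big[setI/setT]_(i < d | (i < k)%N) (X i @^-1` S i).
Definition future_box := \big[setI/setT]_(i < d | (k < i)%N) (Y i @^-1` S i).

Lemma past_boxF : F (widen_ord (leqnSn d) k) past_box.
Proof.
apply: sigma_algebra_bigsetI => // i ik.
(* [lift ord0 i] has value [i + 1], which is at most [k] since [i < k]. *)
apply: (@Fhomo (lift ord0 i)); first by rewrite /= /bump.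
by apply: adapted; exists (S i) => //; rewrite setTI.
Qed.

Lemma measurable_future_box : measurable future_box.
Proof.
apply: bigsetI_measurable => i _; rewrite -[X in measurable X]setTI.
exact: measurable_funP.
Qed.

Lemma g_sigma_preimage_bigsetI (Q : pred 'I_d) (B : 'I_d -> set R) :
  (forall i, measurable (B i)) ->
  g_sigma_preimage Y (\big[setI/setT]_(i | Q i) (Y i @^-1` B i)).
Proof.
move=> mB; apply: sigma_algebra_bigsetI => [|i _].
  exact: smallest_sigma_algebra.
apply: sub_sigma_algebra; rewrite (bigD1 i)//=; left.
by exists (B i) => //; rewrite setTI.
Qed.

(** The past box and the event on [X k] both lie in the last sigma-algebra, of which all the [Y i]
    are independent. *)
Lemma P_past_future_X (A : set R) : measurable A ->
  P (future_box `&` (past_box `&` X k @^-1` A)) =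
  P future_box * P (past_box `&` X k @^-1` A).
Proof.
move=> mA; apply: indepYF; first exact: g_sigma_preimage_bigsetI.
have /(sigma_algebraP (fun A _ => @subsetT _ A))[_ _ _ FI] := sF ord_max.
apply: FI; first by apply: Fhomo past_boxF; rewrite /= ltnW.
apply: (@Fhomo (lift ord0 k)); first by rewrite /= /bump.
by apply: adapted; exists A => //; rewrite setTI.
Qed.

(** Independence of the filtration splits off the past box; mutual independence of the [Y i] then
    separates [Y k] from the later ones. *)
Lemma P_past_future_Y (A : set R) : measurable A ->
  P (future_box `&` Y k @^-1` A `&` past_box) =
  P future_box * P (Y k @^-1` A) * P past_box.
Proof.
move=> mA.
pose J : {set 'I_d} := [set i : 'I_d | (k < i)%N]%SET.
(* A single family of sets describes both the future box (over [J]) and its intersection with the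
   event on [Y k] (over [J] with [k] added). *)
pose B i := if i == k then A else S i.
have mB i : measurable (B i) by rewrite /B; case: ifP.
have kJ : k \notin J by rewrite inE ltnn.
have EB : future_box = \big[setI/setT]_(i in J) (Y i @^-1` B i).
  apply: eq_big => i; first by rewrite inE.
  by move=> ki; rewrite /B; case: eqVneq ki => // ->; rewrite ltnn.
have Bk : B k = A by rewrite /B eqxx.
have YE : future_box `&` Y k @^-1` A =
    \big[setI/setT]_(i in (k |: J)%SET) (Y i @^-1` B i).
  by rewrite big_setU1//= Bk EB setIC.
rewrite indepYF; first last.
- by apply: Fhomo past_boxF; rewrite /= ltnW.
- by rewrite YE; exact: g_sigma_preimage_bigsetI.
rewrite YE (indepY _ mB) big_setU1//= Bk EB (indepY _ mB).
by rewrite [X in X * _]muleC.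
Qed.

(** On the box, [X k] has [P future_box] times its law on the past box, while [Y k] has the
    probability of the box times its full law. The conditional hypothesis compares the two on the
    past box. *)
Lemma integral_box_le (phi : R -> R) :
  @convex_function R R^o [set: R^o] phi -> measurable_fun [set: R] phi ->
  P.-integrable [set: T] (EFin \o (phi \o X k)) ->
  P.-integrable [set: T] (EFin \o (phi \o Y k)) ->
  \int[P]_(w in past_box `&` future_box) (phi (X k w))%:E <=
  \int[P]_(w in past_box `&` future_box) (phi (Y k w))%:E.
Proof.
move=> cphi mphi iX iY.
have mB : measurable past_box by exact: Fm past_boxF.
have mC : measurable future_box by exact: measurable_future_box.
have mA : measurable (past_box `&` future_box) by exact: measurableI.
pose pr (E : set T) : {nonneg R} := NngNum (fine_ge0 (measure_ge0 P E)).
have prE E : measurable E -> (pr E)%:num%:E = P E.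
  by move=> mE; rewrite /= fineK// fin_num_measure.
have PA : P (past_box `&` future_box) = P past_box * P future_box.
  have := P_past_future_Y measurableT.
  by rewrite preimage_setT setIT probability_setT mule1 setIC muleC.
have EX : \int[P]_(w in past_box `&` future_box) (phi (X k w))%:E =
    (pr future_box)%:num%:E * \int[P]_(w in past_box) (phi (X k w))%:E.
  apply: integral_comp_scaled => // [A mA'|]; last exact: integrableS iX.
  by rewrite prE// -P_past_future_X// setIA (setIC future_box).
have EY : \int[P]_(w in past_box `&` future_box) (phi (Y k w))%:E =
    (pr (past_box `&` future_box))%:num%:E * \int[P]_w (phi (Y k w))%:E.
  apply: integral_comp_scaled => // A mA'.
  rewrite prE// setTI -setIA (setIC past_box (_ `&` _)).
  rewrite PA; apply: etrans (P_past_future_Y mA') _.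
  by rewrite muleAC (muleC (P past_box)).
have finE : 'E_P[phi \o Y k] = (fine 'E_P[phi \o Y k])%:E.
  by rewrite fineK// unlock; exact: (integrable_fin_num measurableT iY).
rewrite EX EY !prE// PA (muleC (P past_box)) -muleA lee_wpmul2l//.
have := XleY k cphi; rewrite finE.
move=> /(cond_expectation_le_integral (@Fm _))/(_ past_boxF)/le_trans; apply.
by rewrite -finE unlock muleC.
Qed.

End Box.

Let integrable_mixed n i : P.-integrable [set: T] (EFin \o mixed n i).
Proof. by rewrite /mixed; case: (i < n)%N. Qed.

Lemma mixed_succ (k i : 'I_d) w : i != k -> mixed k.+1 i w = mixed k i w.
Proof.
by move=> ik; rewrite /mixed ltnS leq_eqVlt (inj_eq (@ord_inj d)) (negbTE ik).
Qed.

(* Up to [e], the coordinates other than [k] are frozen on each cell of a grid,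
   and such a cell is a box of the kind treated in [integral_box_le]. *)
Lemma integral_mixed_succ_le (k : 'I_d) (f : 'rV[R]_d -> R) (L : R) :
  @convex_function R 'rV[R]_d [set: _] f -> (0 <= L)%R -> l1_lipschitz L f ->
  preserves_measurability f ->
  \int[P]_w (f (\row_i mixed k.+1 i w))%:E <=
  \int[P]_w (f (\row_i mixed k i w))%:E.
Proof.
move=> cf L0 fL fm.
have iM n : P.-integrable [set: T] (fun w => (f (\row_i mixed n i w))%:E).
  exact: lipschitz_integrable.
rewrite -sube_le0 -integralB//.
apply/lee_addgt0Pr => e e0; rewrite add0e.
(* Freezing the coordinates costs at most [L * d / c] for each of the two vectors; the added 1 keeps
   [M] positive when [L * d = 0]. *)
pose M : R := (2 * (L * d%:R) + 1)%R.
have M0 : (0 < M)%R by rewrite ltr_wpDl// mulr_ge0// mulr_ge0.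
pose c := (M / e)%R; have c0 : (0 < c)%R by rewrite divr_gt0.
have ec : (2 * (L * (d%:R * c^-1)) <= e)%R.
  have -> : (2 * (L * (d%:R * c^-1)) = (M - 1) * e / M)%R.
    by rewrite /c invf_div /M; field; rewrite gt_eqF.
  by rewrite ler_pdivrMr//; nra.
(* Entry [k] is set to 0, so cells do not constrain that coordinate. The other coordinates of
   [mixed k] and [mixed k.+1] agree, so one grid serves both. *)
pose cell (w : T) : nat :=
  pickle (\row_i if i == k then 0%R else Num.floor (mixed k i w * c)%R).
pose A n := [set w | cell w = n].
have cellE w w0 : cell w = cell w0 <-> forall i, i != k ->
    Num.floor (mixed k i w * c) = Num.floor (mixed k i w0 * c).
  split=> [/(pcan_inj pickleK)/rowP ww i /negbTE ik|ww].
    by have := ww i; rewrite !mxE ik.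
  by congr pickle; apply/rowP => i; rewrite !mxE; case: eqVneq => // /ww.
pose S w0 (i : 'I_d) :=
  [set x | Num.floor (x * c) = Num.floor (mixed k i w0 * c)].
have mS w0 i : measurable (S w0 i) by exact: measurable_floor_cell.
have AE w0 : A (cell w0) = past_box k (S w0) `&` future_box k (S w0).
  apply/seteqP; split => w.
    move=> /cellE ww; split; apply/in_bigsetI => i ik; rewrite /= /S /=.
      by rewrite -ww ?/mixed ?ik// neq_ltn ik.
    by rewrite -ww ?/mixed ?ltnNge ?(ltnW ik)// neq_ltn ik orbT.
  move=> [/in_bigsetI pw /in_bigsetI fw]; apply/cellE => i ik.
  have /orP[ltik|ltki] : (i < k)%N || (k < i)%N by rewrite -neq_ltn.
    by rewrite -(pw i ltik) /mixed ltik.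
  by rewrite -(fw i ltki) /mixed ltnNge (ltnW ltki).
have mbox w0 : measurable (A (cell w0)).
  rewrite AE; apply: measurableI; last exact: measurable_future_box.
  exact: Fm (past_boxF _ _).
have A0 n : A n = set0 \/ exists w0, n = cell w0.
  have [[w0 <-]|nex] := pselect (exists w0, cell w0 = n).
    by right; exists w0.
  by left; apply/seteqP; split => w // wn; case: nex; exists w.
pose H w := (f (\row_i mixed k.+1 i w) - f (\row_i mixed k i w))%R.
apply: (@integral_le_of_countable_partition _ _ _ P A H).
- by move=> n; case: (A0 n) => [->//|[w0 ->]].
- apply/trivIsetP => i j _ _ ij; apply/seteqP; split=> w // -[wi wj].
  by move: ij; rewrite -[i]wi -[j]wj eqxx.
- by apply/seteqP; split => w // _; exists (cell w).
- exact: (integrableB measurableT (iM k.+1) (iM k)).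
move=> n; case: (A0 n) => [->|[w0 ->]].
  by rewrite integral_set0 measure0 mule0.
(* The coordinates other than [k] are frozen at their values at the representative [w0] of the
   cell. *)
pose phi := slice f k (mixed k ^~ w0).
have cphi : @convex_function R R^o [set: R^o] phi by exact: slice_convex.
have mphi : measurable_fun [set: R] phi by exact: slice_measurable.
have iphi (Z : {RV P >-> R}) : P.-integrable [set: T] (EFin \o Z) ->
    P.-integrable [set: T] (EFin \o (phi \o Z)).
  (* The slice at [Z] is [f] of a vector with [Z] in place [k] and constants elsewhere, and
     constants are integrable under a probability. *)
  move=> iZ; apply: (@lipschitz_integrable R d _ T P f L
    (fun i w => if i == k then Z w else mixed k i w0)) => // i.
  by case: (i == k) => //; exact: finite_measure_integrable_cst.
have subA (g : T -> \bar R) : P.-integrable [set: T] g ->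
    P.-integrable (A (cell w0)) g by exact: integrableS.
have ie : P.-integrable [set: T] (EFin \o cst e).
  exact: finite_measure_integrable_cst.
have iXY := integrableB measurableT (iphi _ (intX k)) (iphi _ (intY k)).
apply: (@le_trans _ _ (\int[P]_(w in A (cell w0))
    (((phi (X k w))%:E - (phi (Y k w))%:E) + e%:E))).
  apply: le_integral => //.
  - exact: subA (integrableB measurableT (iM k.+1) (iM k)).
  - exact: subA (integrableD measurableT iXY ie).
  move=> w; rewrite inE => /cellE ww; rewrite -EFinB -EFinD lee_fin /H.
  have close i : i != k -> (`|mixed k i w - mixed k i w0| <= c^-1)%R.
    by move=> ik; apply: dist_le_of_floor_eq => //; exact: ww.
  have ci0 : (0 <= c^-1)%R by rewrite invr_ge0 ltW.
  have Xk : mixed k.+1 k w = X k w by rewrite /mixed ltnSn.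
  have Yk : mixed k k w = Y k w by rewrite /mixed ltnn.
  have dist x := @slice_dist R d f k (mixed k ^~ w0) L c^-1 x fL L0 ci0.
  have := dist (\row_i mixed k.+1 i w).
  rewrite mxE Xk => h1.
  have := dist (\row_i mixed k i w).
  rewrite mxE Yk => h2.
  have {}h1 : (`|f (\row_i mixed k.+1 i w) - phi (X k w)| <= L * (d%:R / c))%R.
    by apply: h1 => i ik; rewrite mxE mixed_succ//; exact: close.
  have {}h2 : (`|f (\row_i mixed k i w) - phi (Y k w)| <= L * (d%:R / c))%R.
    by apply: h2 => i ik; rewrite mxE; exact: close.
  by move: h1 h2; rewrite !ler_norml; lra.
rewrite integralD//; last 2 first.
- exact: subA iXY.
- exact: subA ie.
rewrite integral_cst// -[leRHS]add0e leeD2r//.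
rewrite integralB//; last 2 first.
- exact: subA (iphi _ (intX k)).
- exact: subA (iphi _ (intY k)).
rewrite sube_le0 AE; apply: integral_box_le => //; exact: iphi.
Qed.

Lemma lipschitz_convex_integral_le (f : 'rV[R]_d -> R) (L : R) :
  @convex_function R 'rV[R]_d [set: _] f -> (0 <= L)%R -> l1_lipschitz L f ->
  preserves_measurability f ->
  \int[P]_w (f (\row_i X i w))%:E <= \int[P]_w (f (\row_i Y i w))%:E.
Proof.
move=> cf L0 fL fm.
suff H n : (n <= d)%N -> \int[P]_w (f (\row_i mixed n i w))%:E <=
    \int[P]_w (f (\row_i Y i w))%:E.
  apply: le_trans (H d (leqnn d)); rewrite le_eqVlt; apply/orP; left; apply/eqP.
  apply: eq_integral => w _; congr (f _)%:E; apply/rowP => i.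
  by rewrite !mxE /mixed ltn_ord.
elim: n => [_|n IH nd]; first by [].
apply: le_trans (IH (ltnW nd)).
exact: (@integral_mixed_succ_le (Ordinal nd) f L).
Qed.

(** If [f] of [Y] is not integrable, its integral is [+oo], as [g 0] is an integrable minorant.
    Otherwise the limit is taken on the [X] side only, the bound [g n <= f] being enough on the [Y]
    side. *)
Lemma convex_expectation_le (f : 'rV[R]_d -> R) :
  @convex_function R 'rV[R]_d [set: _] f ->
  \int[P]_w (f (\row_i X i w))%:E <= \int[P]_w (f (\row_i Y i w))%:E.
Proof.
move=> cf; have [a [b [abf fab]]] := convex_countable_affine_minorants cf.
pose g := max_affine a b.
have gf n x : (g n x <= f x)%R by exact: max_affine_le.
have gcvg x : g n x @[n --> \oo] --> f x by exact: max_affine_cvg.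
have gm n : preserves_measurability (g n) by exact: max_affine_measurable.
have gi n (Z : 'I_d -> {RV P >-> R}) :
    (forall i, P.-integrable [set: T] (EFin \o Z i)) ->
    P.-integrable [set: T] (fun w => (g n (\row_i Z i w))%:E).
  move=> iZ; have [L _ gL] := max_affine_lipschitz a b n.
  exact: (lipschitz_integrable gL (gm n)).
have gXY n : \int[P]_w (g n (\row_i X i w))%:E <=
    \int[P]_w (g n (\row_i Y i w))%:E.
  have [L L0 gL] := max_affine_lipschitz a b n.
  apply: lipschitz_convex_integral_le gL (gm n) => //.
  exact: max_affine_convex.
have fm : preserves_measurability f.
  move=> disp' T' V mV.
  apply: (@measurable_fun_cvg _ _ _ _ (fun n w => g n (\row_i V i w))) => //.
  by move=> n; exact: gm.
have fmY : measurable_fun [set: T] (fun w => (f (\row_i Y i w))%:E).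
  by apply/measurable_EFinP; exact: fm.
have [iY|niY] :=
  pselect (P.-integrable [set: T] (fun w => (f (\row_i Y i w))%:E)); last first.
  rewrite (integral_eq_pinfty fmY (gi 0%N Y intY) _ niY) ?leey// => w.
  by rewrite lee_fin gf.
rewrite -(fineK (integrable_fin_num measurableT iY)).
apply: (@integral_le_of_nondecreasing_cvg _ _ _ _
  (fun n w => g n (\row_i X i w))) => // [n|w m n mn|n].
- exact: gi.
- exact: max_affine_homo.
rewrite (fineK (integrable_fin_num measurableT iY)).
apply: le_trans (gXY n) _; apply: le_integral => //; first exact: gi.
by move=> w _; rewrite lee_fin gf.
Qed.

End Swap.

Local Open Scope ereal_scope.

(* X i and Y i, for i : 'I_d, stand for X_(i+1) and Y_(i+1); hence the
   sigma-algebra with the same index as X i is F (lift ord0 i), and the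
   preceding one is F (widen_ord (leqnSn d) i). *)
Theorem theorem19 (R : realType) (disp : measure_display)
    (T : measurableType disp) (P : probability T R) (d : nat)
    (F : 'I_d.+1 -> set_system T) (X Y : 'I_d -> {RV P >-> R}) :
  (1 <= d)%N ->
  filtration F ->
  (forall i, P.-integrable [set: T] (EFin \o X i)) ->
  (forall i, measurable_wrt (F (lift ord0 i)) (X i)) ->
  (forall i, P.-integrable [set: T] (EFin \o Y i)) ->
  mutually_independent P Y ->
  independent_systems P (g_sigma_preimage Y) (F ord_max) ->
  (forall (i : 'I_d) (phi : R -> R),
     @convex_function R R^o [set: R^o] phi ->
     cond_expectation_le P (F (widen_ord (leqnSn d) i)) (phi \o X i)
       'E_P[phi \o Y i]) ->
  forall f : 'rV[R]_d -> R,
    @convex_function R 'rV[R]_d [set: 'rV[R]_d] f ->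
    'E_P[fun w => f (\row_i X i w)] <= 'E_P[fun w => f (\row_i Y i w)].
Proof.
move=> _ filtF intX adapted intY indepY indepYF XleY f cf.
by rewrite unlock; apply: convex_expectation_le cf; eassumption.
Qed.
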